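(* The polynomial $1+x_1-x_2$ has the spaced polynomial property when considered as a polynomial in the two variables $x_1,x_2$. It also has the spaced polynomial property when considered as a polynomial in the three variables $x_1,x_2,x_3$.
   Context: A Laurent polynomial $p\in\mathbb{Z}[x_1^{\pm1},\dots,x_d^{\pm1}]$ (considered as a Laurent polynomial in $d$ variables) has the spaced polynomial property if there exists an integer $N>0$ such that for every non-zero Laurent polynomial $u$ in $d$ variables with all coefficients in $\{0,1,-1\}$, $p$ does not divide $u(x_1^N,\dots,x_d^N)$ in $\mathbb{Z}[x_1^{\pm1},\dots,x_d^{\pm1}]$. *)

(* Defs.v *)
From HB Require Import structures.
From mathcomp Require Import all_boot all_order all_algebra.
From mathcomp Require Import finmap.
From mathcomp Require Export monalg.

Set Implicit Arguments.
Unset Strict Implicit.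
Unset Printing Implicit Defensive.

Import GRing.Theory.
Local Open Scope fset_scope.
Local Open Scope ring_scope.

(* Z[x_1^{+-1}, ..., x_d^{+-1}] is the group algebra of the exponent group Z^d.
   [monalg] provides its additive group of finitely supported functions; its
   product requires a monoid without non-trivial units, which excludes Z^d, so
   the convolution product is defined here. *)
Definition laurent (d : nat) : Type := {malg int['rV[int]_d]}.

HB.instance Definition _ d :=
  GRing.Zmodule.copy (laurent d) {malg int['rV[int]_d]}.

Section LaurentRing.
Variable d : nat.
Implicit Types (f g h : laurent d) (k : 'rV[int]_d).

Definition laurent_one : laurent d := << 1 *g 0 >>.

Definition laurent_mul f g : laurent d :=
  \sum_(k1 <- msupp f) \sum_(k2 <- msupp g) << f@_k1 * g@_k2 *g k1 + k2 >>.

Lemma laurent_mulw (d1 d2 : {fset 'rV[int]_d}) f g :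
  msupp f `<=` d1 -> msupp g `<=` d2 ->
  laurent_mul f g
    = \sum_(k1 <- d1) \sum_(k2 <- d2) << f@_k1 * g@_k2 *g k1 + k2 >>.
Proof.
move=> le_d1 le_d2; rewrite /laurent_mul (big_fset_incl _ le_d1) /=.
  apply/eq_bigr=> k1 _; apply/big_fset_incl => // k _ /mcoeff_outdom ->.
  by rewrite mulr0 monalgU0.
move=> k _ /mcoeff_outdom fk.
by rewrite big1 => // k' _; rewrite fk mul0r monalgU0.
Qed.

Lemma laurent_mulC : commutative laurent_mul.
Proof.
move=> f g; rewrite /laurent_mul exchange_big /=.
by apply/eq_bigr=> k1 _; apply/eq_bigr=> k2 _; rewrite mulrC addrC.
Qed.

Lemma laurent_mul0l g : laurent_mul 0 g = 0.
Proof. by rewrite /laurent_mul msupp0 big_seq_fset0. Qed.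

Lemma laurent_mulDl : left_distributive laurent_mul +%R.
Proof.
move=> f g h; rewrite (laurent_mulw (msuppD_le f g) (fsubset_refl (msupp h))).
rewrite (laurent_mulw (fsubsetUl (msupp f) (msupp g)) (fsubset_refl (msupp h))).
rewrite (laurent_mulw (fsubsetUr (msupp f) (msupp g)) (fsubset_refl (msupp h))).
rewrite -big_split /=; apply/eq_bigr=> k1 _.
rewrite -big_split /=; apply/eq_bigr=> k2 _.
by rewrite mcoeffD mulrDl monalgUD.
Qed.

Lemma laurent_mulUU (a b : int) k l :
  laurent_mul << a *g k >> << b *g l >> = << a * b *g k + l >>.
Proof.
by rewrite (laurent_mulw msuppU_le msuppU_le) !big_seq_fset1 !mcoeffUU.
Qed.

Lemma laurent_mul1l : left_id laurent_one laurent_mul.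
Proof.
move=> g; rewrite (laurent_mulw msuppU_le (fsubset_refl _)) big_seq_fset1.
rewrite [RHS]monalgE; apply/eq_bigr=> k _.
by rewrite mcoeffUU mul1r add0r.
Qed.

Lemma laurent_mul_suml (I : Type) (r : seq I) (F : I -> laurent d) g :
  laurent_mul (\sum_(i <- r) F i) g = \sum_(i <- r) laurent_mul (F i) g.
Proof.
exact: (big_morph (laurent_mul^~ g) (fun _ _ => laurent_mulDl _ _ _)
                  (laurent_mul0l g)).
Qed.

Lemma laurent_mul_sumr (I : Type) (r : seq I) (F : I -> laurent d) g :
  laurent_mul g (\sum_(i <- r) F i) = \sum_(i <- r) laurent_mul g (F i).
Proof.
by rewrite laurent_mulC laurent_mul_suml; apply/eq_bigr=> i _;
  rewrite laurent_mulC.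
Qed.

Lemma laurent_mulA : associative laurent_mul.
Proof.
move=> f g h; rewrite [f]monalgE; move: (msupp f) => sf.
rewrite (laurent_mul_suml _ _ g) !(laurent_mul_suml sf).
apply/eq_bigr=> k1 _; rewrite [g]monalgE; move: (msupp g) => sg.
rewrite (laurent_mul_sumr sg) !(laurent_mul_suml sg) (laurent_mul_sumr sg).
apply/eq_bigr=> k2 _; rewrite [h]monalgE; move: (msupp h) => sh.
rewrite !(laurent_mul_sumr sh).
by apply/eq_bigr=> k3 _; rewrite !laurent_mulUU mulrA addrA.
Qed.

Lemma laurent_one_neq0 : laurent_one != 0.
Proof. by rewrite monalgU_eq0. Qed.

HB.instance Definition _ := GRing.Zmodule_isComNzRing.Build (laurent d)
  laurent_mulA laurent_mulC laurent_mul1l laurent_mulDl laurent_one_neq0.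

Definition laurentX (i : 'I_d) : laurent d := << 1 *g delta_mx 0 i >>.

(* u(x_1^N, ..., x_d^N) *)
Definition spread (N : nat) (u : laurent d) : laurent d :=
  \sum_(k <- msupp u) << u@_k *g k *+ N >>.

Definition laurent_dvd (p q : laurent d) : Prop :=
  exists r : laurent d, q = r * p.

Definition spaced_polynomial_property (p : laurent d) : Prop :=
  exists N : nat, (0 < N)%N /\
    forall u : laurent d, u <> 0 -> (forall k, u@_k \in [:: 0; 1; -1]) ->
      ~ laurent_dvd p (spread N u).

End LaurentRing.

(* Main.v *)
(* Let [p = 1 + x_1 - x_2]. For an arc from [conj omega] to [omega] (primitive
   cube roots of unity) avoiding [0] and [-1], put
     W(a,b) = 1/(2 i pi) * \int x^a (1+x)^b ((1+x)/x - 1/(1+x))^2 dx.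
   Since [x_2 = 1 + x_1] on the curve [p = 0], pairing with [W] kills every
   multiple of [p]. Changing the arc alters [W] only by integers, because the
   residues at [0] and [-1] are integers. At the end points [|x| = |1+x| = 1],
   and the integrand vanishes there to second order; whatever [(a,b) <> 0] is,
   one of the three arcs [|x| = 1], [|1+x| = 1], [|x| = |1+x|] makes
   [|x^a (1+x)^b|] decay, so that modulo 1 the weights [W(30a,30b)] with
   [(a,b) <> 0] have absolute sum at most 1/8. On the other hand
   [W(0,0) = 3 sqrt 3 / (2 pi)] is at distance more than 1/8 from the integers.
   If [p] divides [u(x^30)], centre the pairing at a monomial [k0] of [u]: the
   pairing is 0, but modulo 1 it is [+-W(0,0)] up to an error of at most 1/8.

   The arc [|x| = 1], [x = e^(2it)] with [|t| <= pi/3], where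
   [1 + x = 2 cos t e^(it)], makes all these integrals real; the other arcs
   reduce to it through the 3-cycle [x -> -1/(1+x)] of [0, -1, infinity]. *)
From Stdlib Require Import Reals Lra Lia ZArith FunctionalExtensionality.
From Coquelicot Require Import Coquelicot.

Local Open Scope R_scope.

(** * Means over the arc *)

(** For [x = e^(2it)] the form [dx / (2 i pi x)] is [dt / PI]; integrands even in [t] are folded
    onto [[0, PI/3]], hence the factor 2. The total mass is [2/3], the arc being two thirds of the
    circle. *)
Definition mean (f : R -> R) : R := 2 / PI * RInt f 0 (PI / 3).

Definition cont (f : R -> R) : Prop :=
  forall t, 0 <= t <= PI / 3 -> continuous f t.

Lemma PI_gt3 : 3 < PI.
Proof. generalize PI2_3_2; lra. Qed.

(** On the arc, [2 * cos t] is [|1 + x|]; negative powers of it are therefore at most 1. *)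
Lemma cos_ge_half t : 0 <= t <= PI / 3 -> 1 <= 2 * cos t.
Proof.
intros Ht; assert (HP := PI_gt3).
assert (cos (PI / 3) <= cos t) by (apply cos_decr_1; lra).
rewrite cos_PI3 in H; lra.
Qed.

Lemma cont_ex_RInt f : cont f -> ex_RInt f 0 (PI / 3).
Proof.
intros Hf; apply (ex_RInt_continuous (V := R_CompleteNormedModule)); intros t.
assert (HP := PI_gt3).
rewrite Rmin_left, Rmax_right by lra; apply Hf.
Qed.

Lemma mean_ext f g :
  (forall t, 0 <= t <= PI / 3 -> f t = g t) -> mean f = mean g.
Proof.
intros H; unfold mean; f_equal; apply RInt_ext; intros t.
assert (HP := PI_gt3).
rewrite Rmin_left, Rmax_right by lra; intros; apply H; lra.
Qed.

Lemma mean_plus f g :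
  cont f -> cont g -> mean (fun t => f t + g t) = mean f + mean g.
Proof.
intros Hf Hg; unfold mean.
rewrite (RInt_plus (V := R_CompleteNormedModule)) by now apply cont_ex_RInt.
unfold plus; simpl; ring.
Qed.

Lemma mean_scal k f : cont f -> mean (fun t => k * f t) = k * mean f.
Proof.
intros Hf; unfold mean.
rewrite (RInt_scal (V := R_CompleteNormedModule)) by now apply cont_ex_RInt.
unfold scal; simpl; unfold mult; simpl; ring.
Qed.

Lemma mean_le f g : cont f -> cont g ->
  (forall t, 0 <= t <= PI / 3 -> f t <= g t) -> mean f <= mean g.
Proof.
intros Hf Hg H; assert (HP := PI_gt3); unfold mean.
apply Rmult_le_compat_l; [apply Rlt_le, Rdiv_lt_0_compat; lra|].
apply RInt_le; try apply cont_ex_RInt; auto; try lra.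
intros; apply H; lra.
Qed.

Lemma mean_const k : mean (fun _ => k) = 2 / 3 * k.
Proof.
unfold mean; rewrite RInt_const; unfold scal; simpl; unfold mult; simpl.
assert (HP := PI_gt3); field; lra.
Qed.

Lemma cont_plus f g : cont f -> cont g -> cont (fun t => f t + g t).
Proof. intros Hf Hg t Ht; apply (continuous_plus f g); auto. Qed.

Lemma cont_mult f g : cont f -> cont g -> cont (fun t => f t * g t).
Proof. intros Hf Hg t Ht; apply (continuous_mult f g); auto. Qed.

Lemma cont_const k : cont (fun _ => k).
Proof. intros t _; apply continuous_const. Qed.

Lemma mean_derive f F : cont f ->
  (forall t, 0 <= t <= PI / 3 -> is_derive F t (f t)) ->
  mean f = 2 / PI * (F (PI / 3) - F 0).
Proof.
intros Hf HF; unfold mean; f_equal; assert (HP := PI_gt3).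
apply is_RInt_unique, (is_RInt_derive (V := R_CompleteNormedModule));
  rewrite Rmin_left, Rmax_right by lra; auto.
Qed.

(** * Integrals of the monomials [x^a (1+x)^b] over the arc *)

Definition kern (m n t : R) : R := cos (m * t) * Rpower (2 * cos t) n.

Lemma kern_cont m n : cont (kern m n).
Proof.
intros t Ht; apply (ex_derive_continuous (V := R_NormedModule)).
generalize (cos_ge_half t Ht); intros.
unfold kern, Rpower; auto_derive; lra.
Qed.

(* With [x = e^(2it)]: [1/(2 i pi) \int x^a (1+x)^b dx = arc_integral (2a+2+b) b]. *)
Definition arc_integral (m n : R) : R := mean (kern m n).

Lemma arc_integral_opp m n : arc_integral (- m) n = arc_integral m n.
Proof.
apply mean_ext; intros t _; unfold kern.
replace (- m * t) with (- (m * t)) by ring; now rewrite cos_neg.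
Qed.

(** This is [x^a (1+x)^(b+1) = x^a (1+x)^b + x^(a+1) (1+x)^b], read on the arc as the product
    formula for [2 cos t cos (m t)]. *)
Lemma arc_integral_rec m n :
  arc_integral m (n + 1) = arc_integral (m + 1) n + arc_integral (m - 1) n.
Proof.
unfold arc_integral; rewrite <- mean_plus by apply kern_cont; apply mean_ext; intros t Ht.
generalize (cos_ge_half t Ht); intros; unfold kern.
rewrite Rpower_plus, Rpower_1 by lra.
replace ((m + 1) * t) with (m * t + t) by ring.
replace ((m - 1) * t) with (m * t - t) by ring.
rewrite cos_plus, cos_minus; ring.
Qed.

(** The integral of [(1+x)^(k-1)]: the primitive is the imaginary part of [(1+x)^k / (2k)], and
    [2 cos t = 1] at the end point. *)
Lemma arc_integral_diag k : k <> 0 ->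
  arc_integral (k + 1) (k - 1) = sin (k * (PI / 3)) / (PI * k).
Proof.
intros Hk; assert (HP := PI_gt3); unfold arc_integral.
rewrite (mean_derive _ (fun t => sin (k * t) * Rpower (2 * cos t) k / (2 * k))).
- rewrite cos_PI3, Rmult_0_r, sin_0.
  replace (2 * (1 / 2)) with 1 by field.
  unfold Rpower at 1; rewrite ln_1, Rmult_0_r, exp_0; field; lra.
- apply kern_cont.
- intros t Ht; generalize (cos_ge_half t Ht); intros Hc; unfold kern, Rpower.
  auto_derive; [lra|].
  replace ((k + 1) * t) with (k * t + t) by ring.
  replace ((k - 1) * ln (2 * cos t)) with (k * ln (2 * cos t) + - ln (2 * cos t)) by ring.
  rewrite exp_plus, exp_Ropp, exp_ln, cos_plus by lra.
  field; lra.
Qed.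

Lemma arc_integral_zero k : k <> 0 ->
  arc_integral (2 * k) 0 = sin (2 * k * (PI / 3)) / (PI * k).
Proof.
intros Hk; assert (HP := PI_gt3); unfold arc_integral.
rewrite (mean_derive _ (fun t => sin (2 * k * t) / (2 * k))).
- rewrite Rmult_0_r, sin_0; field; lra.
- apply kern_cont.
- intros t Ht; generalize (cos_ge_half t Ht); intros Hc; unfold kern, Rpower.
  rewrite Rmult_0_l, exp_0; auto_derive; [trivial|field; lra].
Qed.

(** The cases left out by [k <> 0]: here [1/x] and, in [arc_integral_1_m1], [1/(1+x)]. The values
    are the variations of the arguments of [x] and [1+x], divided by [2 pi]. *)
Lemma arc_integral_00 : arc_integral 0 0 = 2 / 3.
Proof.
unfold arc_integral; rewrite (mean_ext _ (fun _ => 1)), mean_const; [ring|].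
intros t Ht; generalize (cos_ge_half t Ht); intros; unfold kern.
rewrite Rpower_O, Rmult_0_l, cos_0 by lra; ring.
Qed.

Lemma arc_integral_1_m1 : arc_integral 1 (-1) = 1 / 3.
Proof.
unfold arc_integral; rewrite (mean_ext _ (fun _ => 1 / 2)), mean_const; [field|].
intros t Ht; generalize (cos_ge_half t Ht); intros; unfold kern.
replace (-1) with (Ropp 1) by ring.
rewrite Rpower_Ropp, Rpower_1, Rmult_1_l by lra; field; lra.
Qed.

(* Inserts the factor [(c - 1/c)^2 = c^2 - 2 + 1/c^2], [c = 2 cos t], which is
   [((1+x)/x - 1/(1+x))^2] up to a unit of modulus one. *)
Definition arc_weight (m n : R) : R :=
  arc_integral m (n + 2) - 2 * arc_integral m n + arc_integral m (n - 2).

Lemma arc_weight_rec m n :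
  arc_weight m (n + 1) = arc_weight (m + 1) n + arc_weight (m - 1) n.
Proof.
unfold arc_weight.
replace (n + 1 + 2) with (n + 2 + 1) by ring.
replace (n + 1 - 2) with (n - 2 + 1) by ring.
rewrite !arc_integral_rec; ring.
Qed.

(** * Integrality and change of arc *)

Definition is_int (x : R) : Prop := exists z : Z, x = IZR z.

Lemma is_int_plus x y : is_int x -> is_int y -> is_int (x + y).
Proof. intros [a ->] [b ->]; exists (a + b)%Z; now rewrite plus_IZR. Qed.

Lemma is_int_minus x y : is_int x -> is_int y -> is_int (x - y).
Proof. intros [a ->] [b ->]; exists (a - b)%Z; now rewrite minus_IZR. Qed.

Lemma is_int_mult x y : is_int x -> is_int y -> is_int (x * y).
Proof. intros [a ->] [b ->]; exists (a * b)%Z; now rewrite mult_IZR. Qed.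

(** Row 0 gives all rows above it by addition. Each row below is determined by the one above it up
    to its value at [a = 0], from which differences propagate both ways. *)
Lemma pascal_is_int (D : Z -> Z -> R) :
  (forall a b, D a b + D (a + 1)%Z b = D a (b + 1)%Z) ->
  (forall a, is_int (D a 0%Z)) ->
  (forall b, (b < 0)%Z -> is_int (D 0%Z b)) ->
  forall a b, is_int (D a b).
Proof.
intros Hrec Hrow Hcol.
assert (Hpos : forall b, (0 <= b)%Z -> forall a, is_int (D a b)).
{ apply (natlike_ind (fun b => forall a, is_int (D a b))); [exact Hrow|].
  intros b _ IH a; unfold Z.succ; rewrite <- Hrec; now apply is_int_plus. }
assert (Hneg : forall b, (0 <= b)%Z -> forall a, is_int (D a (- b)%Z)).
{ apply (natlike_ind (fun b => forall a, is_int (D a (- b)%Z))); [exact Hrow|].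
  intros b Hb IH a.
  assert (HE : forall a, D a (- Z.succ b)%Z + D (a + 1)%Z (- Z.succ b)%Z = D a (- b)%Z).
  { intros a'; rewrite Hrec; f_equal; lia. }
  induction a as [|a Ha|a Ha] using Z.peano_ind.
  - apply Hcol; lia.
  - change (Z.succ a) with (a + 1)%Z.
    replace (D (a + 1)%Z _) with (D a (- b)%Z - D a (- Z.succ b)%Z)
      by (rewrite <- (HE a); ring).
    now apply is_int_minus.
  - replace (D (Z.pred a) _) with (D (Z.pred a) (- b)%Z - D a (- Z.succ b)%Z).
    + now apply is_int_minus.
    + rewrite <- (HE (Z.pred a)); replace (Z.pred a + 1)%Z with a by lia; ring. }
intros a b; destruct (Z_le_gt_dec 0 b); [auto|].
replace b with (- (- b))%Z by lia; apply Hneg; lia.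
Qed.

Lemma sin_PI_Z z : sin (PI * IZR z) = 0.
Proof. apply sin_eq_0_1; exists z; ring. Qed.

(** This cosine is the sign [(-1)^z], which the substitution [x -> -1/(1+x)] draws from [x^z]. *)
Lemma cos_PI_Z_is_int z : is_int (cos (PI * IZR z)).
Proof.
assert (H := sin2_cos2 (PI * IZR z)); rewrite sin_PI_Z in H; unfold Rsqr in H.
assert (HE : (cos (PI * IZR z) - 1) * (cos (PI * IZR z) + 1) = 0) by lra.
apply Rmult_integral in HE; destruct HE; [exists 1%Z | exists (-1)%Z]; lra.
Qed.
 
Lemma cos_PI_succ x : cos (PI * (x + 1)) = - cos (PI * x).
Proof.
replace (PI * (x + 1)) with (PI * x + PI) by ring; apply neg_cos.
Qed.

Lemma sin_double_third z :
  sin (2 * IZR z * (PI / 3)) = - cos (PI * IZR z) * sin (IZR z * (PI / 3)).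
Proof.
replace (2 * IZR z * (PI / 3)) with (PI * IZR z - IZR z * (PI / 3)) by field.
rewrite sin_minus, sin_PI_Z; ring.
Qed.

(* The arcs [|x| = 1] and [|x| = |1+x|]: the second integral is pulled back to the
   first arc by the 3-cycle. The differences satisfy Pascal's relation, so it is
   enough to look at [x^a] and [(1+x)^b], which have explicit primitives. *)
Lemma arc_integral_cycle (a b : Z) :
  is_int (arc_integral (2 * IZR a + 2 + IZR b) (IZR b)
          - cos (PI * IZR a) * arc_integral (IZR b - IZR a) (- IZR a - IZR b - 2)).
Proof.
revert a b; assert (HP := PI_gt3).
apply (pascal_is_int (fun a b => _)).
- intros a b; rewrite !plus_IZR, cos_PI_succ.
  generalize (arc_integral_rec (2 * IZR a + 3 + IZR b) (IZR b))
    (arc_integral_rec (IZR b - IZR a) (- IZR a - IZR b - 3)).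
  replace (2 * IZR a + 3 + IZR b + 1) with (2 * (IZR a + 1) + 2 + IZR b) by ring.
  replace (2 * IZR a + 3 + IZR b - 1) with (2 * IZR a + 2 + IZR b) by ring.
  replace (2 * IZR a + 2 + (IZR b + 1)) with (2 * IZR a + 3 + IZR b) by ring.
  replace (- IZR a - IZR b - 3 + 1) with (- IZR a - IZR b - 2) by ring.
  replace (- (IZR a + 1) - IZR b - 2) with (- IZR a - IZR b - 3) by ring.
  replace (- IZR a - (IZR b + 1) - 2) with (- IZR a - IZR b - 3) by ring.
  replace (IZR b - (IZR a + 1)) with (IZR b - IZR a - 1) by ring.
  replace (IZR b + 1 - IZR a) with (IZR b - IZR a + 1) by ring.
  intros -> ->; ring.
- intros a; destruct (Z.eq_dec a (-1)) as [->|Ha].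
  (* The integrand is [1/x], and [2/3 + 1/3 = 1] is its residue at 0, the pole enclosed by the two
     arcs. *)
  + exists 1%Z.
    replace (PI * -1) with (- PI) by ring; rewrite cos_neg, cos_PI.
    replace (2 * -1 + 2 + 0) with 0 by ring.
    replace (0 - -1) with 1 by ring.
    replace (- -1 - 0 - 2) with (-1) by ring.
    rewrite arc_integral_00, arc_integral_1_m1; field.
  + exists 0%Z.
    assert (Hk : IZR (a + 1) <> 0) by (apply not_0_IZR; lia).
    assert (Hk' := Hk); rewrite plus_IZR in Hk'.
    replace (2 * IZR a + 2 + 0) with (2 * IZR (a + 1)) by (rewrite plus_IZR; ring).
    rewrite arc_integral_zero, sin_double_third by easy.
    rewrite plus_IZR, cos_PI_succ.
    replace (0 - IZR a) with (- (IZR a + 1) + 1) by ring.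
    replace (- IZR a - 0 - 2) with (- (IZR a + 1) - 1) by ring.
    rewrite arc_integral_diag by lra.
    replace (- (IZR a + 1) * (PI / 3)) with (- ((IZR a + 1) * (PI / 3))) by ring.
    rewrite sin_neg; field; lra.
- intros b Hb; exists 0%Z; rewrite (Rmult_0_r PI), cos_0.
  destruct (Z.eq_dec b (-1)) as [->|Hb1].
  + replace (2 * 0 + 2 + -1) with 1 by ring.
    replace (-1 - 0) with (- (1)) by ring.
    replace (- 0 - -1 - 2) with (-1) by ring.
    rewrite arc_integral_opp; ring.
  + assert (Hk : IZR (b + 1) <> 0) by (apply not_0_IZR; lia).
    rewrite plus_IZR in Hk.
    replace (2 * 0 + 2 + IZR b) with ((IZR b + 1) + 1) by ring.
    replace (arc_integral (IZR b + 1 + 1) (IZR b))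
      with (arc_integral (IZR b + 1 + 1) (IZR b + 1 - 1))
      by (f_equal; ring).
    rewrite arc_integral_diag by lra.
    (* Evenness in the first argument turns this into the diagonal integral at [- (b + 1)]; the
       diagonal value is even in [k]. *)
    rewrite <- arc_integral_opp.
    replace (- (IZR b - 0)) with (- (IZR b + 1) + 1) by ring.
    replace (- 0 - IZR b - 2) with (- (IZR b + 1) - 1) by ring.
    rewrite arc_integral_diag by lra.
    replace (- (IZR b + 1) * (PI / 3)) with (- ((IZR b + 1) * (PI / 3))) by ring.
    rewrite sin_neg; field; lra.
Qed.

(* Expand [((1+x)/x - 1/(1+x))^2] into three monomials on both arcs. *)
Lemma arc_weight_cycle (a b : Z) :
  is_int (arc_weight (2 * IZR a + IZR b) (IZR b)
          - cos (PI * IZR a) * arc_weight (IZR b - IZR a) (- IZR a - IZR b)).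
Proof.
generalize (is_int_plus _ _ (is_int_minus _ _ (arc_integral_cycle (a - 2) (b + 2))
  (is_int_mult _ _ (ex_intro _ 2%Z eq_refl) (arc_integral_cycle (a - 1) b)))
  (arc_integral_cycle a (b - 2))).
match goal with |- is_int ?x -> is_int ?y => replace y with x; [easy|] end.
rewrite !minus_IZR, !plus_IZR.
set (x := IZR a); set (y := IZR b).
assert (C1 : cos (PI * (x - 1)) = - cos (PI * x)).
{ rewrite <- (Ropp_involutive (cos (PI * (x - 1)))), <- cos_PI_succ.
  f_equal; f_equal; f_equal; ring. }
assert (C2 : cos (PI * (x - 2)) = cos (PI * x)).
{ rewrite <- (Ropp_involutive (cos (PI * (x - 2)))), <- cos_PI_succ.
  replace (x - 2 + 1) with (x - 1) by ring; rewrite C1; ring. }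
rewrite C1, C2; unfold arc_weight.
replace (2 * (x - 2) + 2 + (y + 2)) with (2 * x + y) by ring.
replace (2 * (x - 1) + 2 + y) with (2 * x + y) by ring.
replace (2 * x + 2 + (y - 2)) with (2 * x + y) by ring.
set (m := y - x); set (n := - x - y - 2).
replace (y + 2 - (x - 2)) with (m + 4) by (unfold m; ring).
replace (y - (x - 1)) with (m + 1) by (unfold m; ring).
replace (y - 2 - x) with (m - 2) by (unfold m; ring).
replace (- (x - 2) - (y + 2) - 2) with n by (unfold n; ring).
replace (- (x - 1) - y - 2) with (n + 1) by (unfold n; ring).
replace (- x - (y - 2) - 2) with (n + 1 + 1) by (unfold n; ring).
replace (- x - y + 2) with (n + 1 + 1 + 1 + 1) by (unfold n; ring).
replace (- x - y - 2) with n by (unfold n; ring).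
replace (- x - y) with (n + 1 + 1) by (unfold n; ring).
(* Everything is lowered to the exponent [n]; first arguments are then normalised to
   [m - 4, ..., m + 4] so that [ring] recognises equal integrals. *)
rewrite !arc_integral_rec.
repeat match goal with |- context [arc_integral ?p n] =>
  match p with
  | m + IZR _ => fail 1 | m - IZR _ => fail 1 | m => fail 1 | 2 * x + y => fail 1
  | _ => first
    [ replace p with m by ring | replace p with (m + 1) by ring
    | replace p with (m + 2) by ring | replace p with (m + 3) by ring
    | replace p with (m + 4) by ring | replace p with (m - 1) by ring
    | replace p with (m - 2) by ring | replace p with (m - 3) by ring
    | replace p with (m - 4) by ring ]
  end end.
ring.
Qed.

(** The central terms in the expansion of [arc_integral 0 2] cancel [2 * arc_integral 0 0]. Three
    equal terms remain, as [sin (2 pi / 3) = sin (pi / 3)]. *)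
Lemma arc_weight_00 : arc_weight 0 0 = 3 * sin (PI / 3) / PI.
Proof.
assert (HP := PI_gt3); unfold arc_weight.
replace (0 + 2) with (0 + 1 + 1) by ring; rewrite !arc_integral_rec.
replace (0 + 1 + 1) with (2 * 1) by ring.
replace (0 + 1 - 1) with 0 by ring.
replace (0 - 1 + 1) with 0 by ring.
replace (0 - 1 - 1) with (- (2 * 1)) by ring.
rewrite arc_integral_opp, arc_integral_zero by lra.
replace (arc_integral 0 (0 - 2)) with (arc_integral (-1 + 1) (-1 - 1)) by (f_equal; ring).
rewrite arc_integral_diag by lra.
replace (2 * 1 * (PI / 3)) with (PI - PI / 3) by field.
rewrite sin_PI_x.
replace (-1 * (PI / 3)) with (- (PI / 3)) by ring; rewrite sin_neg; field; lra.
Qed.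

Lemma arc_weight_00_bounds : 1 / 8 < arc_weight 0 0 < 7 / 8.
Proof.
rewrite arc_weight_00, sin_PI3; assert (HP := PI_gt3); assert (HP4 := PI_4).
assert (Hs : 0 <= sqrt 3) by apply sqrt_pos.
assert (Hs2 : sqrt 3 * sqrt 3 = 3) by (apply sqrt_sqrt; lra).
(* The bound [7/4] suffices exactly: [3/2 * 7/4 = 7/8 * 3 < 7/8 * PI]. *)
assert (1 <= sqrt 3 <= 7 / 4) by (split; nra).
assert (HE : 3 * (sqrt 3 / 2) / PI * PI = 3 * (sqrt 3 / 2)) by (field; lra).
split; apply (Rmult_lt_reg_r PI); lra.
Qed.

(** * Decay of the weights *)

Definition spread_kern (n : nat) (t : R) : R :=
  (2 * cos t - / (2 * cos t))² * ((/ (2 * cos t)) ^ 10) ^ n.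

Definition weight_tail (n : nat) : R := mean (spread_kern n).

Lemma spread_kern_cont n : cont (spread_kern n).
Proof.
intros t Ht; generalize (cos_ge_half t Ht); intros.
apply (ex_derive_continuous (V := R_NormedModule)).
unfold spread_kern, Rsqr; auto_derive; lra.
Qed.

Definition arc_weight_kern (m n t : R) : R :=
  kern m (n + 2) t + (-2 * kern m n t + kern m (n - 2) t).

Lemma arc_weight_kern_cont m n : cont (arc_weight_kern m n).
Proof.
assert (H : cont (fun t => -2 * kern m n t)).
{ apply (cont_mult (fun _ => -2)); [apply cont_const|apply kern_cont]. }
apply (cont_plus (kern m (n + 2))); [apply kern_cont|].
apply (cont_plus (fun t => -2 * kern m n t)); [exact H|apply kern_cont].
Qed.

Lemma arc_weight_mean m n : arc_weight m n = mean (arc_weight_kern m n).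
Proof.
assert (H : cont (fun t => -2 * kern m n t)).
{ apply (cont_mult (fun _ => -2)); [apply cont_const|apply kern_cont]. }
unfold arc_weight_kern.
rewrite (mean_plus (kern m (n + 2)) (fun t => -2 * kern m n t + kern m (n - 2) t)).
- rewrite (mean_plus (fun t => -2 * kern m n t)) by (exact H || apply kern_cont).
  rewrite mean_scal by apply kern_cont; unfold arc_weight, arc_integral; ring.
- apply kern_cont.
- apply (cont_plus (fun t => -2 * kern m n t)); [exact H|apply kern_cont].
Qed.

(** Follows from [|cos| <= 1] and [2 cos t >= 1]. The 10 is [30 / 3]: exponents are dilated by 30,
    and a suitable arc gains at least a third of [k = |a| + |b|]. *)
Lemma arc_weight_bound m n (k : nat) : n <= - (10 * INR k) ->
  Rabs (arc_weight m n) <= weight_tail k.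
Proof.
intros Hn.
assert (HJ := arc_weight_mean m n); assert (Hc := arc_weight_kern_cont m n).
assert (Hb : forall t, 0 <= t <= PI / 3 ->
  Rabs (arc_weight_kern m n t) <= spread_kern k t).
{ intros t Ht; generalize (cos_ge_half t Ht); intros Hc1.
  unfold arc_weight_kern, kern, spread_kern.
  replace (Rpower (2 * cos t) (n + 2)) with (Rpower (2 * cos t) n * (2 * cos t)²).
  2:{ rewrite Rpower_plus; f_equal.
      replace 2 with (INR 2) at 3 by reflexivity.
      rewrite Rpower_pow by lra; unfold Rsqr; ring. }
  replace (Rpower (2 * cos t) (n - 2)) with (Rpower (2 * cos t) n * (/ (2 * cos t))²).
  2:{ unfold Rminus; rewrite Rpower_plus, Rpower_Ropp; f_equal.
      replace 2 with (INR 2) at 3 by reflexivity.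
      rewrite Rpower_pow by lra; unfold Rsqr; field; lra. }
  set (c := 2 * cos t) in *.
  match goal with |- Rabs ?x <= _ =>
    replace x with (cos (m * t) * ((c - / c)² * Rpower c n))
      by (unfold Rsqr; field; lra) end.
  assert (H0 : 0 <= (c - / c)²) by apply Rle_0_sqr.
  assert (H1 : 0 < Rpower c n) by apply exp_pos.
  rewrite Rabs_mult, (Rabs_pos_eq (_ * _)) by (apply Rmult_le_pos; lra).
  apply Rle_trans with (1 * ((c - / c)² * Rpower c n)).
  - apply Rmult_le_compat_r; [apply Rmult_le_pos; lra|].
    apply Rabs_le, COS_bound.
  - rewrite Rmult_1_l; apply Rmult_le_compat_l; [easy|].
    rewrite !pow_inv, <- pow_mult, <- Rpower_pow by lra.
    rewrite <- Rpower_Ropp; apply Rle_Rpower; [easy|].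
    rewrite mult_INR; simpl (INR 10); lra. }
rewrite HJ; apply Rabs_le; split.
- replace (- weight_tail k) with (mean (fun t => -1 * spread_kern k t)).
  2:{ rewrite mean_scal by apply spread_kern_cont; unfold weight_tail; ring. }
  apply mean_le;
    [apply (cont_mult (fun _ => -1)); [apply cont_const|apply spread_kern_cont]|easy|].
  intros t Ht; specialize (Hb t Ht); apply Rabs_le_between in Hb; lra.
- apply mean_le; [easy|apply spread_kern_cont|].
  intros t Ht; specialize (Hb t Ht); apply Rabs_le_between in Hb; lra.
Qed.

(** [W(a,b)]: the monomials with exponents [(a-2, b+2)], [(a-1, b)], [(a, b-2)] all have first
    argument [2 * a + b]. *)
Definition weight (a b : R) : R := arc_weight (2 * a + b) b.

Lemma weight_far_int (z : Z) : 1 / 8 < Rabs (weight 0 0 - IZR z).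
Proof.
unfold weight; replace (2 * 0 + 0) with 0 by ring; assert (H := arc_weight_00_bounds).
destruct (Z_le_gt_dec z 0) as [Hz|Hz].
- apply IZR_le in Hz; rewrite Rabs_pos_eq; lra.
- assert (Hz1 : (1 <= z)%Z) by lia.
  apply IZR_le in Hz1; rewrite Rabs_left; lra.
Qed.

Lemma weight_rec a b : weight a b + weight (a + 1) b = weight a (b + 1).
Proof.
unfold weight; replace (2 * a + (b + 1)) with (2 * a + b + 1) by ring.
rewrite arc_weight_rec.
replace (2 * a + b + 1 + 1) with (2 * (a + 1) + b) by ring.
replace (2 * a + b + 1 - 1) with (2 * a + b) by ring; ring.
Qed.

Lemma weight_bound (a b : Z) (k : nat) : Z.of_nat k = (Z.abs a + Z.abs b)%Z ->
  exists z : Z, Rabs (weight (30 * IZR a) (30 * IZR b) - IZR z) <= weight_tail k.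
Proof.
intros Hk.
assert (Hs : forall z, Rabs (cos (PI * IZR z)) <= 1)
  by (intros; apply Rabs_le, COS_bound).
(* Some one of [-a], [-b], [a + b] is at least [(|a| + |b|) / 3]; it selects the arc. *)
assert (H : (Z.of_nat k <= - 3 * b \/
  Z.of_nat k <= 3 * (a + b) \/ Z.of_nat k <= - 3 * a)%Z) by lia.
set (x := (30 * a)%Z); set (y := (30 * b)%Z).
replace (30 * IZR a) with (IZR x) by (unfold x; now rewrite mult_IZR).
replace (30 * IZR b) with (IZR y) by (unfold y; now rewrite mult_IZR).
destruct H as [H|[H|H]]; apply IZR_le in H; rewrite <- INR_IZR_INZ in H;
  rewrite ?mult_IZR, ?plus_IZR in H.
- exists 0%Z; rewrite Rminus_0_r.
  apply arc_weight_bound; unfold y; rewrite mult_IZR; lra.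
(* On the arc [|x| = |1+x|], one turn of the cycle makes [- x - y] the decay exponent. *)
- destruct (arc_weight_cycle x y) as [z Hz]; exists z; unfold weight; rewrite <- Hz.
  match goal with |- Rabs ?x <= _ => ring_simplify x end.
  rewrite Rabs_mult, <- (Rmult_1_l (weight_tail k)).
  apply Rmult_le_compat; try apply Rabs_pos; [apply Hs|].
  apply arc_weight_bound; unfold x, y; rewrite !mult_IZR; lra.
(* On the arc [|1+x| = 1], a second turn makes [x] the decay exponent; its integer is multiplied by
   the sign of the first turn. *)
- destruct (arc_weight_cycle x y) as [z Hz].
  destruct (is_int_mult _ _ (cos_PI_Z_is_int x) (arc_weight_cycle y (- x - y)))
    as [z' Hz'].
  exists (z + z')%Z; unfold weight; rewrite plus_IZR, <- Hz, <- Hz', minus_IZR, opp_IZR.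
  replace (2 * IZR y + (- IZR x - IZR y)) with (IZR y - IZR x) by ring.
  match goal with |- Rabs ?x <= _ => ring_simplify x end.
  rewrite !Rabs_mult, <- (Rmult_1_l (weight_tail k)), <- (Rmult_1_l 1).
  repeat apply Rmult_le_compat; try apply Rabs_pos; try apply Hs.
  + apply Rmult_le_pos; apply Rabs_pos.
  + apply arc_weight_bound; unfold x, y; rewrite !mult_IZR; lra.
Qed.

Close Scope R_scope.

Require Import Defs.
From mathcomp Require Import all_boot all_order all_algebra finmap.
From mathcomp Require Import Rstruct zify ssrZ.

Import Order.TTheory GRing.Theory Num.Theory.
Local Open Scope ring_scope.
Delimit Scope R_scope with coqR.

(** * Sums of weights over the lattice *)

Lemma mean_sum (I : Type) (s : seq I) (F : I -> R -> R) :
  (forall i, cont (F i)) ->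
  cont (fun t => \sum_(i <- s) F i t) /\
  mean (fun t => \sum_(i <- s) F i t) = \sum_(i <- s) mean (F i).
Proof.
move=> cF; elim: s => [|i s [cs ms]].
  have -> : (fun t => \sum_(i <- [::]) F i t) = (fun _ => 0).
    by apply: functional_extensionality => t; rewrite big_nil.
  by split; [apply: cont_const | rewrite big_nil mean_const Rmult_0_r].
have -> : (fun t => \sum_(j <- i :: s) F j t)
        = (fun t => (F i t + \sum_(j <- s) F j t)%R).
  by apply: functional_extensionality => t; rewrite big_cons.
by split; [apply: cont_plus | rewrite mean_plus // ms big_cons].
Qed.

(** [Negz i] is [- (i + 1)], so the negative half has one index fewer. *)
Definition int_ball (n : nat) : seq int :=
  [seq Posz i | i <- iota 0 n.+1] ++ [seq Negz i | i <- iota 0 n].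

Lemma mem_int_ball n (a : int) : (`|a| <= n)%N -> a \in int_ball n.
Proof.
rewrite mem_cat; case: a => a Ha; first by rewrite map_f // mem_iota.
by rewrite orbC map_f // mem_iota.
Qed.

Lemma int_ball_uniq n : uniq (int_ball n).
Proof.
rewrite cat_uniq !map_inj_uniq ?iota_uniq ?andbT; try by move=> ? ? [].
by apply/hasPn => _ /mapP[i _ ->]; apply/mapP => -[].
Qed.

(** The two halves are geometric sums starting at [1] and at [z]. No division by [1 - z], because
    [z = 1] occurs at the end of the arc. *)
Lemma geometric_int_ball (K : realDomainType) n (z : K) : 0 <= z <= 1 ->
  0 <= (1 - z) * \sum_(a <- int_ball n) z ^+ `|a| <= 1 + z.
Proof.
move=> /andP[z0 z1]; apply/andP; split.
  by rewrite mulr_ge0 ?subr_ge0 // sumr_ge0 // => i _; rewrite exprn_ge0.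
have G m : (1 - z) * \sum_(i <- iota 0 m) z ^+ i <= 1.
  have -> : \sum_(i <- iota 0 m) z ^+ i = \sum_(i < m) z ^+ i.
    by rewrite -(big_mkord xpredT (fun i => z ^+ i)) /index_iota subn0.
  by rewrite -opprB mulNr -subrX1 opprB lerBlDr lerDl exprn_ge0.
rewrite big_cat !big_map mulrDr; apply: lerD; first exact: G.
have -> : \sum_(j <- iota 0 n) z ^+ `|Negz j| = z * \sum_(j <- iota 0 n) z ^+ j.
  by rewrite mulr_sumr; apply: eq_bigr => j _; rewrite -exprS.
by rewrite mulrCA ler_piMr ?G.
Qed.

Lemma ler_sum_sub_uniq (K : numDomainType) (I : eqType) (s T : seq I) (F : I -> K) :
  (forall i, 0 <= F i) -> uniq s -> uniq T -> {subset s <= T} ->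
  \sum_(i <- s) F i <= \sum_(i <- T) F i.
Proof.
move=> F0 us uT sT.
have -> : \sum_(i <- s) F i = \sum_(i <- [seq i <- T | i \in s]) F i.
  apply: perm_big; apply: uniq_perm; rewrite ?filter_uniq // => i.
  by rewrite mem_filter; case: (boolP (i \in s)) => // /sT ->.
rewrite big_filter [X in X <= _]big_mkcond; apply: ler_sum => i _.
by case: ifP.
Qed.

(** With the origin adjoined, the sum is at most the square of a sum over [int_ball]; then
    [(1 + z)^2 - (1 - z)^2 = 4z]. *)
Lemma sum_lattice_bound (K : realDomainType) (s : seq (int * int)) (z : K) :
  0 <= z <= 1 -> uniq s -> (0, 0) \notin s ->
  (1 - z) ^+ 2 * \sum_(p <- s) z ^+ (`|p.1| + `|p.2|) <= 4 * z.
Proof.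
move=> z01 us s0; have /andP[z0 z1] := z01.
(* A crude radius: the sum of all norms bounds each of them. *)
pose n := (\sum_(p <- s) (`|p.1| + `|p.2|))%N.
have le_n p : p \in s -> (`|p.1| + `|p.2| <= n)%N.
  by move=> ps; rewrite /n (big_rem _ ps) leq_addr.
pose T := [seq (a, b) | a <- int_ball n, b <- int_ball n].
pose S := \sum_(a <- int_ball n) z ^+ `|a|.
have /andP[S0 S1] : 0 <= (1 - z) * S <= 1 + z by apply: geometric_int_ball.
have sumT : \sum_(p <- (0, 0) :: s) z ^+ (`|p.1| + `|p.2|) <= S ^+ 2.
  have -> : S ^+ 2 = \sum_(p <- T) z ^+ (`|p.1| + `|p.2|).
    rewrite big_allpairs expr2 /S big_distrlr /=.
    by apply: eq_bigr => a _; apply: eq_bigr => b _; rewrite exprD.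
  apply: ler_sum_sub_uniq.
  - by move=> p; rewrite exprn_ge0.
  - by rewrite cons_uniq s0.
  - by apply: allpairs_uniq; rewrite ?int_ball_uniq // => -[a b] [c d].
  - move=> [a b]; rewrite inE => H.
    have le_ab : (`|a| + `|b| <= n)%N by case/orP: H => [/eqP[-> ->]|/le_n].
    apply: allpairs_f; apply: mem_int_ball; apply: leq_trans le_ab.
      exact: leq_addr.
    exact: leq_addl.
rewrite big_cons /= expr0 in sumT.
have : (1 - z) ^+ 2 * (1 + \sum_(p <- s) z ^+ (`|p.1| + `|p.2|)) <= (1 + z) ^+ 2.
  apply: (le_trans (ler_wpM2l (sqr_ge0 _) sumT)).
  by rewrite -exprMn ler_sqr ?nnegrE // addr_ge0.
have -> : (1 + z) ^+ 2 = (1 - z) ^+ 2 + 4 * z.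
  by rewrite -[LHS](subrK ((1 - z) ^+ 2)) subr_sqrDB mul1r -mulr_natl addrC.
by rewrite mulrDr mulr1 lerD2l.
Qed.

(** The lattice sum at [z = d^10] may grow like [(1 - z)^-2] near the end point; the double zero
    [(c - d)^2] compensates. Since [c * d = 1], [1 - z = d^5 * (c^5 - d^5) = d^5 * (c - d) * q] with
    [q >= 5], whence [4 / 25]. *)
Lemma spread_kern_sum (s : seq (int * int)) t :
  (0 <= t <= PI / 3)%coqR -> uniq s -> (0, 0) \notin s ->
  (\sum_(p <- s) spread_kern (`|p.1| + `|p.2|) t <= 4 / 25)%coqR.
Proof.
move=> Ht us s0; have c1 := cos_ge_half t Ht.
set c := Rmult 2 (cos t) in c1.
pose d := Rinv c; have cd : (c * d = 1)%coqR by rewrite /d; apply: Rinv_r; lra.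
have d0 : (0 < d)%coqR by apply: Rinv_0_lt_compat; lra.
have d1 : (d <= 1)%coqR by nra.
have z0 : (0 < pow d 10)%coqR by apply: pow_lt.
have z1 : (pow d 10 <= 1)%coqR by have := pow_incr d 1 10; rewrite pow1; lra.
have -> : \sum_(p <- s) spread_kern (`|p.1| + `|p.2|) t
  = (Rsqr (c - d) * \sum_(p <- s) (pow d 10) ^+ (`|p.1| + `|p.2|))%coqR.
  rewrite RmultE mulr_sumr; apply: eq_bigr => p _.
  exact: (congr1 (Rmult _) (RpowE _ _)).
set S := \sum_(p <- s) _.
have S0 : (0 <= S)%coqR.
  by apply/RleP; apply: sumr_ge0 => p _; apply: exprn_ge0; apply/RleP; exact: Rlt_le.
have HS : ((1 - pow d 10) * (1 - pow d 10) * S <= 4 * pow d 10)%coqR.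
  have E4 : IZR 4 = 4%:R by rewrite !RealsE.
  apply/RleP; rewrite RminusE !RmultE R1E E4 -expr2.
  by apply: sum_lattice_bound => //; apply/andP; split; apply/RleP => //; exact: Rlt_le.
pose q := (c ^ 4 + c ^ 2 + 1 + d ^ 2 + d ^ 4)%coqR.
have Ec : c = (/ d)%coqR by rewrite /d Rinv_inv.
have q5 : (5 <= q)%coqR.
  have -> : q = (5 + (c - d) ^ 2 + (c ^ 2 - d ^ 2) ^ 2)%coqR.
    by rewrite /q Ec; field; lra.
  by have := pow2_ge_0 (c - d); have := pow2_ge_0 (c ^ 2 - d ^ 2); lra.
have Ez : (1 - d ^ 10 = d ^ 5 * ((c - d) * q))%coqR. by rewrite /q Ec; field; lra.
have H5 : ((c - d) * q * ((c - d) * q) * S <= 4)%coqR.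
  apply: (Rmult_le_reg_l (d ^ 10)%coqR) => //.
  rewrite Ez in HS; apply: Rle_trans (Rle_trans _ _ _ _ HS) _; last by lra.
  by apply: Req_le; ring.
have Hq : (25 * (c - d)² <= (c - d) * q * ((c - d) * q))%coqR.
  have q2 : (25 <= q * q)%coqR by nra.
  by have := Rmult_le_compat_l _ _ _ (Rle_0_sqr (c - d)) q2; rewrite /Rsqr; lra.
by have := Rmult_le_compat_r S _ _ S0 Hq; lra.
Qed.

Lemma weight_tail_sum (s : seq (int * int)) : uniq s -> (0, 0) \notin s ->
  (\sum_(p <- s) weight_tail (`|p.1| + `|p.2|) <= 1 / 8)%coqR.
Proof.
move=> us s0.
have [cs <-] := mean_sum _ s _
  (fun p : int * int => spread_kern_cont (`|p.1| + `|p.2|)).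
(* The mass [2/3] of the arc gives [8/75], below [1/8]. *)
apply: (Rle_trans _ (2 / 3 * (4 / 25))); last by lra.
rewrite -mean_const; apply: mean_le => //; first exact: cont_const.
move=> t Ht; exact: spread_kern_sum Ht us s0.
Qed.

Lemma IZR_Z_of_int (a : int) : IZR (Z_of_int a) = a%:~R.
Proof.
have posE (n : nat) : IZR (Z.of_nat n) = n%:R by rewrite -INR_IZR_INZ INRE.
case: a => n; first exact: posE.
by rewrite [LHS]opp_IZR posE addn1 NegzE mulrNz.
Qed.

Local Opaque weight weight_tail.
Lemma weight_int_bound (a b : int) : exists z : int,
  (Rabs (weight (a *+ 30)%:~R (b *+ 30)%:~R - z%:~R) <= weight_tail (`|a| + `|b|))%coqR.
Proof.
have H : Z.of_nat (`|a| + `|b|)%N = Z.add (Z.abs (Z_of_int a)) (Z.abs (Z_of_int b)).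
  by lia.
have E30 : IZR 30 = 30%:R by rewrite !RealsE.
have scale (c : int) : (c *+ 30)%:~R = Rmult 30 (IZR (Z_of_int c)).
  by rewrite IZR_Z_of_int RmultE E30 mulr_natl rmorphMn.
have [z Hz] := weight_bound _ _ _ H; exists (int_of_Z z).
by rewrite !scale -(IZR_Z_of_int (int_of_Z z)) int_of_ZK.
Qed.

Lemma weight_int_rec (a b : int) :
  weight a%:~R b%:~R + weight (a + 1)%:~R b%:~R = weight a%:~R (b + 1)%:~R.
Proof. by rewrite !rmorphD; apply: weight_rec. Qed.

(** * Pairing Laurent polynomials with weights *)

(** [phi] is an arbitrary function on exponents, so the pairing is only additive. *)
Definition pairing d (phi : 'rV[int]_d -> R) (f : laurent d) : R :=
  mmap (intmul 1 : int -> R) phi f.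

Lemma pairingD d (phi : 'rV[int]_d -> R) : {morph pairing d phi : f g / f + g}.
Proof. exact: mmapD. Qed.

Lemma pairingB d (phi : 'rV[int]_d -> R) : {morph pairing d phi : f g / f - g}.
Proof. exact: mmapB. Qed.

Lemma pairing_sum d (phi : 'rV[int]_d -> R) (I : Type) (s : seq I) (F : I -> laurent d) :
  pairing d phi (\sum_(i <- s) F i) = \sum_(i <- s) pairing d phi (F i).
Proof.
have p0 : pairing d phi 0 = 0 by exact: mmap0.
exact: (big_morph (pairing d phi) (pairingD d phi) p0).
Qed.

Lemma pairingU d (phi : 'rV[int]_d -> R) a k :
  pairing d phi << a *g k >> = a%:~R * phi k.
Proof. exact: mmapU. Qed.

Lemma mul_laurentX d (f : laurent d) i :
  f * laurentX i = \sum_(k <- msupp f) << f@_k *g k + delta_mx 0 i >>.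
Proof.
rewrite [LHS](laurent_mulw (fsubset_refl _) msuppU_le).
by apply: eq_bigr => k _; rewrite big_seq_fset1 mcoeffUU mulr1.
Qed.

Lemma pairing_mulX d (phi : 'rV[int]_d -> R) (f : laurent d) i :
  pairing d phi (f * laurentX i) = pairing d (fun k => phi (k + delta_mx 0 i)) f.
Proof.
rewrite mul_laurentX pairing_sum; apply: eq_bigr => k _.
by rewrite pairingU.
Qed.

(** Multiplication by a variable is adjoint to a translation of [phi], so the recurrence makes each
    monomial of [f] contribute 0. *)
Lemma pairing_eq0 d (phi : 'rV[int]_d -> R) (i j : 'I_d) (f : laurent d) :
  (forall k, phi k + phi (k + delta_mx 0 i) = phi (k + delta_mx 0 j)) ->
  pairing d phi (f * (1 + laurentX i - laurentX j)) = 0.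
Proof.
move=> H.
have -> : f * (1 + laurentX i - laurentX j) = f + f * laurentX i - f * laurentX j.
  by rewrite mulrBr mulrDr mulr1.
apply: (etrans (pairingB _ _ _ _)).
apply: (etrans (congr2 _ (pairingD _ _ _ _) erefl)).
apply: (etrans (congr2 (fun x y => pairing d phi f + x - y)
  (pairing_mulX _ phi f i) (pairing_mulX _ phi f j))).
apply/eqP; rewrite subr_eq0; apply/eqP.
rewrite /pairing /mmap -big_split.
by apply: eq_bigr => k _; rewrite -H mulrDr.
Qed.

Lemma pairing_spread d (phi : 'rV[int]_d -> R) N (u : laurent d) :
  pairing d phi (spread N u) = \sum_(k <- msupp u) (u@_k)%:~R * phi (k *+ N).
Proof. by rewrite pairing_sum; apply: eq_bigr => k _; rewrite pairingU. Qed.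

(** Integer coefficients of modulus at most 1 preserve integrality and do not amplify errors. *)
Lemma near_int_sum (I : Type) (s : seq I) (c : I -> int) (x e : I -> R) :
  (forall i, `|(c i)%:~R : R| <= 1) ->
  (forall i, exists z : int, `|x i - z%:~R| <= e i) ->
  exists z : int, `|\sum_(i <- s) (c i)%:~R * x i - z%:~R| <= \sum_(i <- s) e i.
Proof.
move=> c1 xe; elim: s => [|i s [z Hz]].
  by exists 0; rewrite !big_nil subrr normr0.
have [y Hy] := xe i; exists (c i * y + z); rewrite !big_cons rmorphD rmorphM /=.
rewrite opprD addrACA -mulrBr; apply: (le_trans (ler_normD _ _)).
apply: lerD => //; rewrite normrM -[e i]mul1r; exact: ler_pM.
Qed.

(** * Weights in dimension [n + 2], supported on the plane of the first two exponents *)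

Section Plane.
Variable n : nat.
Implicit Type k : 'rV[int]_n.+2.

Definition in_plane k : bool := [forall i : 'I_n.+2, (1 < i)%N ==> (k 0 i == 0)].

(** Extension by 0 keeps the recurrence: multiplying by [x_1] or [x_2] never enters or leaves the
    plane. *)
Definition plane_weight k : R :=
  if in_plane k then weight (k 0 0)%:~R (k 0 1)%:~R else 0.

Lemma in_plane_delta k (i : 'I_n.+2) : (i <= 1)%N ->
  in_plane (k + delta_mx 0 i) = in_plane k.
Proof.
move=> i1; apply: eq_forallb => j; case: (ltnP 1 j) => //= j1.
rewrite !mxE; have [ji|] := eqVneq j i; last by rewrite addr0.
by move: j1; rewrite ji ltnNge i1.
Qed.

Lemma plane_weight_rec k :
  plane_weight k + plane_weight (k + delta_mx 0 0) = plane_weight (k + delta_mx 0 1).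
Proof.
rewrite /plane_weight !in_plane_delta //; case: ifP => _; last by rewrite addr0.
rewrite !mxE !eqxx /= !addr0; exact: weight_int_rec.
Qed.

Lemma in_planeMn k N : (0 < N)%N -> in_plane (k *+ N) = in_plane k.
Proof.
move=> N0; apply: eq_forallb => j.
by rewrite mulmxnE mulrn_eq0 eqn0Ngt N0.
Qed.

Lemma in_plane_inj k k' : in_plane k -> in_plane k' ->
  (k 0 0, k 0 1) = (k' 0 0, k' 0 1) -> k = k'.
Proof.
move=> /forallP pk /forallP pk' [E0 E1]; apply/rowP => i.
have [i1|] := ltnP 1 i.
  by move: (pk i) (pk' i); rewrite i1 => /eqP -> /eqP ->.
rewrite leq_eqVlt ltnS leqn0 => /orP[] /eqP Hi.
  by have -> : i = 1 by apply: val_inj.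
by have -> : i = 0 by apply: val_inj.
Qed.

Definition plane_tail k : R :=
  if in_plane k then weight_tail (`|k 0 0| + `|k 0 1|) else 0.

Lemma plane_weight_bound k :
  exists z : int, `|plane_weight (k *+ 30) - z%:~R| <= plane_tail k.
Proof.
rewrite /plane_weight /plane_tail in_planeMn //; case: ifP => _; last first.
  by exists 0; rewrite subrr normr0.
have [z Hz] := weight_int_bound (k 0 0) (k 0 1); exists z.
by rewrite !mulmxnE; move/RleP: Hz; rewrite RabsE.
Qed.

(** Projection to the first two coordinates is injective on the plane, which reduces this to
    [weight_tail_sum]. *)
Lemma plane_tail_sum (s : seq 'rV[int]_n.+2) : uniq s -> 0 \notin s ->
  (\sum_(k <- s) plane_tail k <= 1 / 8)%coqR.
Proof.
move=> us s0; rewrite -big_mkcond -big_filter.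
rewrite -(big_map (fun k => (k 0 0, k 0 1)) xpredT
            (fun p : int * int => weight_tail (`|p.1| + `|p.2|))).
apply: weight_tail_sum.
  rewrite map_inj_in_uniq ?filter_uniq // => k k'.
  by rewrite !mem_filter => /andP[pk _] /andP[pk' _]; apply: in_plane_inj.
apply/mapP => -[k]; rewrite mem_filter => /andP[pk ks] E0.
move: s0; have -> // : 0 = k; last by rewrite ks.
apply: in_plane_inj => //; last by rewrite -E0 !mxE.
by apply/forallP => i; rewrite mxE eqxx implybT.
Qed.

Lemma spaced_1_plus_X0_minus_X1 :
  @spaced_polynomial_property n.+2 (1 + laurentX 0 - laurentX 1).
Proof.
exists 30%N; split => // u u0 uc [r Hr].
case: (fset_0Vmem (msupp u)) => [supp0|[k0 k0u]].
  by case: u0; rewrite [u]monalgE supp0 big_seq_fset0.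
(* This translation gives the monomial [k0] the weight [W(0,0)], and the recurrence is translation
   invariant. *)
pose phi k := plane_weight (k - k0 *+ 30).
have : pairing _ phi (spread 30 u) = 0.
  rewrite Hr; apply: pairing_eq0 => k.
  by rewrite /phi ![k + _ - _]addrAC; apply: plane_weight_rec.
rewrite pairing_spread.
rewrite (big_fsetD1 k0) //.
rewrite {1}/phi subrr.
have -> : plane_weight 0 = weight 0 0.
  rewrite /plane_weight ifT ?mxE //.
  by apply/forallP => i; rewrite mxE eqxx implybT.
under eq_bigr => k _ do rewrite /phi -mulrnBl.
set s := (msupp u `\ k0)%fset.
have [|i|z] := @near_int_sum _ s (fun k => u@_k)
    (fun k => plane_weight ((k - k0) *+ 30)) (fun k => plane_tail (k - k0)).
- by move=> k; have := uc k; rewrite !inE => /or3P[] /eqP ->;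
    rewrite ?normr0 ?normr1 ?normrN1.
- exact: plane_weight_bound.
set S := \sum_(k <- s) _ => Hz S0.
have sum_le : (\sum_(k <- s) plane_tail (k - k0) <= 1 / 8)%coqR.
  rewrite -(big_map (fun k => k - k0) xpredT plane_tail); apply: plane_tail_sum.
    by rewrite map_inj_uniq ?fset_uniq //; apply: addIr.
  apply/mapP => -[k ks /esym/eqP]; rewrite subr_eq0 => /eqP Ek.
  by move: ks; rewrite Ek !inE eqxx.
have {Hz} Hz : (Rabs (S - z%:~R) <= 1 / 8)%coqR.
  by apply: Rle_trans sum_le; rewrite RabsE; apply/RleP.
have far y : (1 / 8 < Rabs (weight 0 0 - y%:~R))%coqR.
  by rewrite -IZR_Z_of_int; apply: weight_far_int.
have {S0} S0 : S = - ((u@_k0)%:~R * weight 0 0).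
  have E0 : (u@_k0)%:~R * weight 0 0 + S = 0 by exact: S0.
  by apply/eqP; rewrite -addr_eq0 addrC; apply/eqP.
(* A zero coefficient contradicts [k0] being in the support; [1] and [-1] would put [weight 0 0]
   within [1/8] of [- z] and [z] respectively. *)
move: Hz; rewrite S0 RminusE; have := uc k0; rewrite !inE => /or3P[] /eqP u1; rewrite u1.
- by move: k0u; rewrite -mcoeff_neq0 u1 eqxx.
- have -> : - (1%:~R * weight 0 0) - z%:~R = - (weight 0 0 - (- z)%:~R).
    by move: (weight 0 0) => W; rewrite mulr1z mul1r rmorphN opprK opprD.
  by rewrite RabsE normrN -RabsE => /Rle_not_lt; apply; apply: far.
- have -> : - ((-1)%:~R * weight 0 0) - z%:~R = weight 0 0 - z%:~R.
    by rewrite mulrN1z mulN1r opprK.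
  by move/Rle_not_lt; apply; apply: far.
Qed.
End Plane.

Theorem corollary5p8 :
  @spaced_polynomial_property 2
    (1 + laurentX (0 : 'I_2) - laurentX (1 : 'I_2)) /\
  @spaced_polynomial_property 3
    (1 + laurentX (0 : 'I_3) - laurentX (1 : 'I_3)).
Proof. by split; apply: spaced_1_plus_X0_minus_X1. Qed.
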